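(* Let $A$ be a finite set with $\kappa=|A|$, let $2\le h\le\kappa$, and let $\rho\subseteq A^h$ be a totally reflexive and totally symmetric relation with $\rho\neq\iota_h^A$ and $\rho\neq A^h$. Suppose that for every subset $D=\{d_1,\dots,d_h\}$ of $A$ with $(d_1,\dots,d_h)\notin\rho$ there exist $n\ge1$ and an $n$-ary $q\in Pol(\rho)$ whose restriction to $D^n$ takes every value of $A$. Then $Pol(\rho)$ is a maximal clone on $A$.
   Context: $\iota_h^A=\{(a_1,\dots,a_h)\in A^h:\exists i\neq j\ a_i=a_j\}$; $\rho$ is totally reflexive iff $\iota_h^A\subseteq\rho$, totally symmetric iff invariant under all permutations of coordinates. A clone is a set of finitary operations on $A$ containing the projections and closed under composition; maximal means maximal among clones different from the clone of all operations. $Pol(\rho)$ is the set of finitary operations on $A$ preserving $\rho$. *)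

(* Defs.v *)
From mathcomp Require Import all_boot all_fingroup.

Set Implicit Arguments.
Unset Strict Implicit.
Unset Printing Implicit Defensive.

Definition op (A : finType) (n : nat) := {ffun n.-tuple A -> A}.

(* Operations have positive arity: an opset of index n holds operations of
   arity n.+1. *)
Definition opset (A : finType) := forall n : nat, op A n.+1 -> Prop.

Definition opset_sub (A : finType) (C D : opset A) : Prop :=
  forall (n : nat) (f : op A n.+1), C n f -> D n f.

Definition opset_full (A : finType) : opset A := fun _ _ => True.

Definition proj_op (A : finType) (n : nat) (i : 'I_n) : op A n :=
  [ffun x : n.-tuple A => tnth x i].

Definition comp_op (A : finType) (n m : nat) (f : op A n)
    (g : 'I_n -> op A m) : op A m :=
  [ffun x : m.-tuple A => f [tuple g i x | i < n]].

Definition is_clone (A : finType) (C : opset A) : Prop :=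
  (forall (n : nat) (i : 'I_n.+1), C n (proj_op A i)) /\
  (forall (n m : nat) (f : op A n.+1) (g : 'I_n.+1 -> op A m.+1),
     C n f -> (forall i, C m (g i)) -> C m (comp_op f g)).

Definition is_proper_clone (A : finType) (C : opset A) : Prop :=
  is_clone C /\ ~ opset_sub (@opset_full A) C.

Definition is_maximal_clone (A : finType) (C : opset A) : Prop :=
  is_proper_clone C /\
  (forall D : opset A, is_proper_clone D -> opset_sub C D -> opset_sub D C).

Definition iota_rel (A : finType) (h : nat) : {set h.-tuple A} :=
  [set a : h.-tuple A |
    [exists i : 'I_h, exists j : 'I_h, (i != j) && (tnth a i == tnth a j)]].

Definition totally_reflexive (A : finType) (h : nat)
    (rho : {set h.-tuple A}) : Prop :=
  iota_rel A h \subset rho.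

Definition totally_symmetric (A : finType) (h : nat)
    (rho : {set h.-tuple A}) : Prop :=
  forall (s : {perm 'I_h}) (a : h.-tuple A),
    a \in rho -> [tuple tnth a (s i) | i < h] \in rho.

Definition preserves (A : finType) (h n : nat) (f : op A n)
    (rho : {set h.-tuple A}) : Prop :=
  forall r : 'I_n -> h.-tuple A, (forall j, r j \in rho) ->
    [tuple f [tuple tnth (r j) i | j < n] | i < h] \in rho.

Definition Pol (A : finType) (h : nat) (rho : {set h.-tuple A}) : opset A :=
  fun n f => preserves f rho.

(* Main.v *)
Require Import Defs.
From mathcomp Require Import all_boot all_fingroup.

(** If [f] maps tuples [r_1, ..., r_n] of [rho] coordinatewise to [d] outside
    [rho], then every operation with values in [{d_1, ..., d_h}] has the form
    [f (u_1, ..., u_n)], where [u_l] takes its values among the entries of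
    [r_l].  Such a [u_l] preserves [rho], since an [h]-tuple of entries of [r_l]
    either repeats an entry or permutes [r_l].  Composing with the operation [q]
    that maps the powers of [{d_1, ..., d_h}] onto [A] yields all operations. *)

Section TotallyReflexiveSymmetric.

Variables (A : finType) (h : nat) (rho : {set h.-tuple A}).
Hypothesis rho_refl : totally_reflexive rho.
Hypothesis rho_sym : totally_symmetric rho.

Lemma reindex_in_rel (t : h.-tuple A) (s : 'I_h -> 'I_h) :
  t \in rho -> [tuple tnth t (s i) | i < h] \in rho.
Proof.
move=> t_rho; have [/injectiveP s_inj | /injectivePn[i [j ij sij]]] :=
  boolP (injectiveb s).
  have := rho_sym (perm s_inj) t t_rho; congr (_ \in rho).
  by apply: eq_from_tnth => i; rewrite !tnth_mktuple permE.
apply: (subsetP rho_refl); rewrite inE.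
apply/existsP; exists i; apply/existsP; exists j.
by rewrite ij !tnth_mktuple sij /=.
Qed.

Lemma preserves_range (m : nat) (t : h.-tuple A) (c : m.-tuple A -> 'I_h) :
  t \in rho -> preserves [ffun x => tnth t (c x)] rho.
Proof.
move=> t_rho r _.
have := reindex_in_rel t (fun i => c [tuple tnth (r j) i | j < m]) t_rho.
by congr (_ \in rho); apply: eq_from_tnth => i; rewrite !tnth_mktuple ffunE.
Qed.

End TotallyReflexiveSymmetric.

Lemma Pol_is_clone (A : finType) (h : nat) (rho : {set h.-tuple A}) :
  is_clone (Pol rho).
Proof.
split=> [n i r r_rho | n m f g f_pol g_pol r r_rho].
  have := r_rho i; congr (_ \in rho).
  by apply: eq_from_tnth => k; rewrite tnth_mktuple ffunE tnth_mktuple.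
have := f_pol _ (fun i => g_pol i r r_rho); congr (_ \in rho).
apply: eq_from_tnth => k; rewrite !tnth_mktuple ffunE; congr (f _).
by apply: eq_from_tnth => i; rewrite !tnth_mktuple.
Qed.

(** Some [t] in [rho] has pairwise distinct entries, so a unary operation can send it entrywise to
    any tuple, in particular to one outside [rho]. *)
Lemma Pol_not_full (A : finType) (h : nat) (rho : {set h.-tuple A}) :
  ~~ (rho \subset iota_rel A h) -> rho <> [set: h.-tuple A] ->
  ~ opset_sub (@opset_full A) (Pol rho).
Proof.
move=> /subsetPn[t t_rho t_inj] /eqP neq_full full.
have /subsetPn[d _ /negP[]] : ~~ ([set: h.-tuple A] \subset rho).
  by rewrite subTset.
(* [f] sends each [tnth t i] to [tnth d i]; elements that are not entries of [t] are fixed, an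
   arbitrary choice. *)
pose f : op A 1 :=
  [ffun x => if [pick i | tnth t i == thead x] is Some i then tnth d i
             else thead x].
have := full 0 f I (fun=> t) (fun=> t_rho); congr (_ \in rho).
apply: eq_from_tnth => i; rewrite tnth_mktuple ffunE /thead tnth_mktuple.
case: pickP => [j /eqP tji | /(_ i)]; last by rewrite eqxx.
have [-> //|ji] := eqVneq j i.
case/negP: t_inj; rewrite inE; apply/existsP; exists j.
by apply/existsP; exists i; rewrite ji tji /=.
Qed.

(** Positions in [d] are recorded rather than values, so that the same positions can later be read
    in other tuples. *)
Lemma onto_reindex (A : finType) (h n : nat) (q : op A n) (d : h.-tuple A) :
  (forall a, exists x : n.-tuple A, (forall j, tnth x j \in d) /\ q x = a) ->
  exists c : A -> 'I_n -> 'I_h,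
    forall a, q [tuple tnth d (c a j) | j < n] = a.
Proof.
move=> q_onto; apply: (fin_all_exists
  (P := fun a c => q [tuple tnth d (c j) | j < n] = a)) => a.
have [x [x_d <-]] := q_onto a.
have [c xE] : exists c : 'I_n -> 'I_h, forall j, tnth x j = tnth d (c j).
  apply: (fin_all_exists (P := fun j i => tnth x j = tnth d i)) => j.
  exact/tnthP.
exists c; congr (q _).
by apply: eq_from_tnth => j; rewrite tnth_mktuple xE.
Qed.

Theorem theorem3p20 (A : finType) (h : nat) (rho : {set h.-tuple A})
  (h_ge2 : 2 <= h) (h_le : h <= #|A|)
  (rho_refl : totally_reflexive rho)
  (rho_sym : totally_symmetric rho)
  (rho_neq_iota : rho <> iota_rel A h)
  (rho_neq_full : rho <> [set: h.-tuple A])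
  (rho_onto : forall (D : {set A}) (d : h.-tuple A),
     D = [set x in d] -> d \notin rho ->
     exists (n : nat) (q : op A n.+1),
       Pol rho q /\
       (forall a : A, exists x : n.+1.-tuple A,
          (forall j, tnth x j \in D) /\ q x = a)) :
  is_maximal_clone (Pol rho).
Proof.
split=> [|D [[_ D_comp] D_proper] PolD n f fD r r_rho].
  split; [exact: Pol_is_clone | apply: Pol_not_full => //].
  (* By total reflexivity, inclusion in [iota_rel A h] would force equality. *)
  by move/eqP: rho_neq_iota; apply: contra => sub; rewrite eqEsubset sub.
(* If [d] were outside [rho], every operation [g] would lie in [D], against properness. *)
set d := (X in X \in rho); apply: contraT => d_notin; case: D_proper => m g _.
have [k [q [q_pol q_onto]]] := rho_onto _ d erefl d_notin.
have [|c qc] := onto_reindex _ _ _ q d.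
  by move=> a; have [x [xd qx]] := q_onto a; exists x; split=> // j;
     have := xd j; rewrite inE.
(* All inner operations read their [r l] at the same position [c (g x) j], so [f] returns the entry
   of [d] there, and [q] maps these entries to [g x]. *)
have -> : g = comp_op q (fun j => comp_op f (fun l =>
            [ffun x => tnth (r l) (c (g x) j)])).
  apply/ffunP=> x; rewrite ffunE -[LHS]qc; congr (q _).
  apply: eq_from_tnth => j; rewrite !tnth_mktuple ffunE; congr (f _).
  by apply: eq_from_tnth => l; rewrite !tnth_mktuple ffunE.
apply: (D_comp) => [|j]; first exact: PolD.
by apply: D_comp => // l; apply/PolD/preserves_range.
Qed.
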